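(* There is a universal constant $c>0$ such that for every series-parallel poset $P$, the quantum query complexity of $\textsc{Sort}_P$ is at least $c\log(|\Delta(P)|)$.
   Context: A poset $P=(A,\le_P)$ has a finite ground set $A$ of $n$ elements. A linear extension of $P$ is a bijection $\sigma:A\to[n]$ (with $\sigma(i)$ the rank of $i$) such that $i\le_P j\implies\sigma(i)\le\sigma(j)$; $\Delta(P)$ denotes the set of linear extensions. $\textsc{Sort}_P$ is the problem: given $P$, identify an unknown $\sigma\in\Delta(P)$, where access to $\sigma$ is only through comparison queries of the form ''is $\sigma(i)\le\sigma(j)$?''. The quantum query complexity of $\textsc{Sort}_P$ is the minimum number of such comparison queries made (in the worst case) by a quantum decision tree (quantum query algorithm, with bounded error) that solves $\textsc{Sort}_P$. Given posets $P,Q$ on disjoint ground sets, the series composition $P\oplus Q$ is the poset on the union in which $x\le y$ iff $x\le_P y$, or $x\le_Q y$, or $x\in P$ and $y\in Q$; the parallel composition $P+Q$ is the poset on the union in which $x\le y$ iff $x\le_P y$ or $x\le_Q y$. A poset is series-parallel iff it is a singleton or is the series or parallel composition of two series-parallel posets. *)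

(* Defs.v *)
From HB Require Import structures.
From mathcomp Require Import all_boot all_order all_algebra.
From mathcomp Require Import spectral complex.
From mathcomp Require Import classical_sets reals ereal constructive_ereal.

Set Implicit Arguments.
Unset Strict Implicit.
Unset Printing Implicit Defensive.

Import Order.TTheory GRing.Theory Num.Theory.
Local Open Scope ring_scope.

(* A poset on a finite ground set is a [finPOrderType].  Two posets on disjoint
   ground sets are composed on the disjoint sum of their carriers. *)

Definition series_comp (P Q : Type) : Type := (P + Q)%type.
Definition parallel_comp (P Q : Type) : Type := (P + Q)%type.

Fact composition_display : Order.disp_t. Proof. exact: Order.Disp tt tt. Qed.

Section Composition.
Context (d1 d2 : Order.disp_t) (P : finPOrderType d1) (Q : finPOrderType d2).

Definition series_le (x y : P + Q) : bool :=
  match x, y with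
  | inl p, inl p' => (p <= p')%O
  | inr q, inr q' => (q <= q')%O
  | inl _, inr _ => true
  | inr _, inl _ => false
  end.

Definition parallel_le (x y : P + Q) : bool :=
  match x, y with
  | inl p, inl p' => (p <= p')%O
  | inr q, inr q' => (q <= q')%O
  | _, _ => false
  end.

Fact series_le_refl : reflexive series_le.
Proof. by case=> x /=. Qed.
Fact series_le_anti : antisymmetric series_le.
Proof. by case=> x [] y //= /le_anti ->. Qed.
Fact series_le_trans : transitive series_le.
Proof. by case=> y [] x [] z //=; apply: le_trans. Qed.

Fact parallel_le_refl : reflexive parallel_le.
Proof. by case=> x /=. Qed.
Fact parallel_le_anti : antisymmetric parallel_le.
Proof. by case=> x [] y //= /le_anti ->. Qed.
Fact parallel_le_trans : transitive parallel_le.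
Proof. by case=> y [] x [] z //=; apply: le_trans. Qed.

HB.instance Definition _ := Finite.copy (series_comp P Q) (P + Q)%type.
HB.instance Definition _ := Order.Le_isPOrder.Build composition_display
  (series_comp P Q) series_le_refl series_le_anti series_le_trans.

HB.instance Definition _ := Finite.copy (parallel_comp P Q) (P + Q)%type.
HB.instance Definition _ := Order.Le_isPOrder.Build composition_display
  (parallel_comp P Q) parallel_le_refl parallel_le_anti parallel_le_trans.

Definition isomorphic_posets : Prop :=
  exists2 f : P -> Q, bijective f & {mono f : x y / (x <= y)%O}.

End Composition.

(* The class is closed under isomorphism, because a ground set that is the
   disjoint union of two others is a sum type only up to relabelling. *)
Inductive series_parallel : forall d : Order.disp_t, finPOrderType d -> Prop :=
| sp_singleton (d : Order.disp_t) (P : finPOrderType d) :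
    #|P| = 1%N -> series_parallel P
| sp_series (d d1 d2 : Order.disp_t) (P : finPOrderType d)
    (P1 : finPOrderType d1) (P2 : finPOrderType d2) :
    series_parallel P1 -> series_parallel P2 ->
    isomorphic_posets (series_comp P1 P2) P -> series_parallel P
| sp_parallel (d d1 d2 : Order.disp_t) (P : finPOrderType d)
    (P1 : finPOrderType d1) (P2 : finPOrderType d2) :
    series_parallel P1 -> series_parallel P2 ->
    isomorphic_posets (parallel_comp P1 P2) P -> series_parallel P.

(* Ranks are counted from 0; an injection between sets of equal cardinality
   is a bijection. *)
Definition linear_extensions (d : Order.disp_t) (P : finPOrderType d) :
    {set {ffun P -> 'I_#|P|}} :=
  [set s : {ffun P -> 'I_#|P|} |
    injectiveb s && [forall i, forall j, (i <= j)%O ==> (s i <= s j)%N]].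

(* Computational basis: two registers holding the elements to be compared, the
   answer qubit, and a workspace of arbitrary finite dimension. *)
Definition qbasis (A W : finType) : finType := (A * A * bool * W)%type.

(* Elements of the basis are numbered by [enum_rank]; states are column
   vectors. *)
Definition qop (R : realType) (B : finType) := 'M[R[i]]_#|B|.
Definition qstate (R : realType) (B : finType) := 'cV[R[i]]_#|B|.

Definition basis_state (R : realType) (B : finType) (x : B) : qstate R B :=
  delta_mx (enum_rank x) 0.

(* |i, j, b, w> |-> |i, j, b xor [s i <= s j], w> *)
Definition query_map (A W : finType) (n : nat) (s : A -> 'I_n)
    (x : qbasis A W) : qbasis A W :=
  let: (i, j, b, w) := x in (i, j, b (+) (s i <= s j)%N, w).

Definition comparison_oracle (R : realType) (A W : finType) (n : nat)
    (s : A -> 'I_n) : qop R (qbasis A W) :=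
  \matrix_(x, y) (enum_val x == query_map s (enum_val y))%:R.

(* The algorithm applies [prelude], then for each U in [steps] one oracle call
   followed by U, and finally measures all registers in the computational
   basis, post-processing the outcome by [output]. *)
Record quantum_algorithm (R : realType) (A : finType) (Out : Type) := {
  workspace_dim : nat;
  workspace := 'I_workspace_dim;
  start : qbasis A workspace;
  prelude : qop R (qbasis A workspace);
  steps : seq (qop R (qbasis A workspace));
  output : qbasis A workspace -> Out;
  prelude_unitary : prelude \is unitarymx;
  steps_unitary : {in steps, forall U, U \is unitarymx}
}.

Section Run.
Context (R : realType) (A : finType) (Out : eqType).

Definition num_queries (a : quantum_algorithm R A Out) : nat := size (steps a).

Definition final_state (a : quantum_algorithm R A Out) (n : nat)
    (s : A -> 'I_n) : qstate R (qbasis A (workspace a)) :=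
  foldl (fun psi U => U *m (comparison_oracle R (workspace a) s *m psi))
        (prelude a *m basis_state R (start a)) (steps a).

(* The value is a real number, embedded in R[i]. *)
Definition output_probability (a : quantum_algorithm R A Out) (n : nat)
    (s : A -> 'I_n) (o : Out) : R[i] :=
  \sum_(x | output (enum_val x) == o) `|final_state a s x 0| ^+ 2.

End Run.

Definition solves_sort (R : realType) (d : Order.disp_t) (P : finPOrderType d)
    (a : quantum_algorithm R P {ffun P -> 'I_#|P|}) : Prop :=
  forall s : {ffun P -> 'I_#|P|}, s \in linear_extensions P ->
    2%:R / 3%:R <= output_probability a s s.

(* An infimum of natural numbers, hence a minimum as soon as some algorithm
   solves the problem. *)
Definition sort_quantum_query_complexity (R : realType) (d : Order.disp_t)
    (P : finPOrderType d) : \bar R :=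
  ereal_inf [set ((num_queries a)%:R)%:E | a in @solves_sort R d P].

(* Main.v *)
Require Import Defs.
From HB Require Import structures.
From mathcomp Require Import all_boot all_order all_algebra.
From mathcomp Require Import spectral complex.
From mathcomp Require Import reals constructive_ereal ereal exp.
From mathcomp Require Import ring lra zify.

(* Adversary argument.  Join a linear extension [s] to every linear extension
   obtained from it by moving one element [m] ranks up, with weight [1 / m].
   - A query separates the ends of an edge only when it compares the moved
     element with one that it passes, so for each query the weights form copies
     of Hilbert's matrix [1 / (a + b + 1)], whose norm is bounded.  Hence one
     query increases the weighted sum of the squared distances
     [|psi_s - psi_t|^2] over the edges by at most a constant times the number
     [N] of linear extensions, while at the end this sum is at least a ninth of
     the total weight.
   - The total weight is the sum over [s] and over the elements [x] of the
     harmonic number [H_k], where [k] is the number of ranks that [x] can move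
     up in [s].  It is additive under series composition; under parallel
     composition, averaging over the shuffles increases it by exactly
     [(p + q) H_(p+q) - p H_p - q H_q >= ln 'C(p + q, p)].  By induction it is
     at least [N ln N] for series-parallel posets. *)

Set Implicit Arguments.
Unset Strict Implicit.
Unset Printing Implicit Defensive.

Import Order.TTheory GRing.Theory Num.Theory.
Local Open Scope ring_scope.

(** * Harmonic numbers and shuffles *)

Section Harmonic.
Context {R : realType}.

Definition harm (n : nat) : R := \sum_(0 <= k < n) k.+1%:R^-1.

Lemma harmS n : harm n.+1 = harm n + n.+1%:R^-1.
Proof. by rewrite /harm big_nat_recr. Qed.

Lemma harm_ge0 n : 0 <= harm n.
Proof. by apply: sumr_ge0 => k _; rewrite invr_ge0. Qed.

(** Raising [p] by one multiplies the ratio by [1 + 1 / (p + q + 1)], and [ln (1 + x) <= x]. *)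
Lemma ln_ratio_le_harm p q :
  ln ((p + q).+1%:R / q.+1%:R) <= harm (p + q) - harm q :> R.
Proof.
elim: p => [|p IH].
  by rewrite add0n divff ?pnatr_eq0 // ln1 subrr.
have -> : (p.+1 + q).+1%:R / q.+1%:R
    = (1 + (p + q).+1%:R^-1) * ((p + q).+1%:R / q.+1%:R) :> R.
  rewrite addSn -(natr1 (p + q).+1); field.
  by rewrite -!natrD !nat1r !pnatr_eq0.
rewrite lnM ?posrE ?divr_gt0 ?ltr0n ?addr_gt0 ?invr_gt0 ?ltr0n //.
rewrite addSn harmS.
have inv_gt0 : 0 < (p + q).+1%:R^-1 :> R by rewrite invr_gt0 ltr0n.
have := le_ln1Dx (lt_trans (ltrN10 R) inv_gt0).
by move: IH; move: ((p + q).+1%:R^-1) (ln _) (ln (_ / _)) => a b c; lra.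
Qed.

Definition shuffle_gain (p q : nat) : R :=
  (p + q)%:R * harm (p + q) - p%:R * harm p - q%:R * harm q.

(** Raising [q] by one multiplies the binomial by [(p + q + 1) / (q + 1)] and raises the gain by
    exactly [harm (p + q) - harm q], so [ln_ratio_le_harm] gives each step. *)
Lemma ln_bin_le_shuffle_gain p q : ln 'C(p + q, p)%:R <= shuffle_gain p q.
Proof.
rewrite /shuffle_gain; elim: q => [|q IH].
  by rewrite addn0 binn ln1 mul0r !subrr.
have binE : 'C(p + q.+1, p)%:R
    = (p + q).+1%:R / q.+1%:R * 'C(p + q, p)%:R :> R.
  have := mul_bin_down (p + q).+1 p.
  rewrite addnS subSn ?leq_addr // addKn /= => /(congr1 (fun k => k%:R : R)).
  rewrite !natrM => E; rewrite mulrAC E; field.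
  by rewrite nat1r pnatr_eq0.
rewrite binE lnM ?posrE ?divr_gt0 ?ltr0n ?bin_gt0 ?leq_addr //.
have := ln_ratio_le_harm p q.
rewrite addnS !harmS !mulrDr !divff ?pnatr_eq0 // -!(natr1) -?addnS.
rewrite !mulrDl !mul1r natrD; move: IH; rewrite natrD; lra.
Qed.

End Harmonic.

Section Slack.
Context {R : realType} {T : Type}.

(** [find (lt x) w'] is the number of places that [x] can move to the right without passing a letter
    above it; if there is no such letter, [find] returns the length and [x] can move to the end. *)
Fixpoint slack (lt : rel T) (w : seq T) : R :=
  if w is x :: w' then harm (find (lt x) w') + slack lt w' else 0.

Lemma slack_ge0 lt w : 0 <= slack lt w.
Proof. by elim: w => //= x w IH; rewrite addr_ge0 ?harm_ge0. Qed.

End Slack.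

Lemma slack_map (R : realType) (T U : Type) (f : T -> U) (lt : rel T)
    (lt' : rel U) (w : seq T) :
  (forall x y, lt' (f x) (f y) = lt x y) ->
  slack lt' (map f w) = slack lt w :> R.
Proof.
move=> ltE; elim: w => //= x w ->; rewrite find_map; congr (harm _ + _).
by apply: eq_find => y /=; rewrite ltE.
Qed.

(** * Shuffles of two words *)

Section Shuffle.
Context {P Q : eqType}.
Implicit Types (s : seq P) (t : seq Q) (w : seq (P + Q)).

Definition inl_part w : seq P := pmap (fun z => if z is inl x then Some x else None) w.
Definition inr_part w : seq Q := pmap (fun z => if z is inr y then Some y else None) w.

Fixpoint shuffle s t : seq (seq (P + Q)) :=
  if s is x :: s' then
    (fix shuffle_s t :=
       if t is y :: t' then
         map (cons (inl x)) (shuffle s' t) ++ map (cons (inr y)) (shuffle_s t')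
       else [:: map inl s]) t
  else [:: map inr t].

Lemma shuffle_nilr s : shuffle s [::] = [:: map inl s].
Proof. by case: s. Qed.

Lemma shuffle_cons x s y t :
  shuffle (x :: s) (y :: t) =
    map (cons (inl x)) (shuffle s (y :: t))
      ++ map (cons (inr y)) (shuffle (x :: s) t).
Proof. by []. Qed.

Lemma mem_map_cons (z z' : P + Q) w (l : seq (seq (P + Q))) :
  (z' :: w \in map (cons z) l) = (z' == z) && (w \in l).
Proof.
apply/mapP/andP => [[w' lw' [-> ->]] // | [/eqP-> lw]].
by exists w.
Qed.

(** With this characterisation, identities between lists of shuffles, up to permutation, reduce to
    comparing the two parts of a word. *)
Lemma mem_shuffle s t w :
  (w \in shuffle s t) = (inl_part w == s) && (inr_part w == t).
Proof.
elim: w s t => [|z w IH] s t.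
  case: s t => [|x s] [|y t] //; rewrite shuffle_cons mem_cat.
  by apply/negbTE/norP; split; apply/mapP=> -[].
case: s => [|x s].
  rewrite inE; case: z => [x|y]; case: t => [|y' t] //=; first by rewrite andbF.
  rewrite !eqseq_cons (inj_eq (@inr_inj _ _)) /= [in RHS]andbCA; congr andb.
  by rewrite -IH inE.
case: t => [|y t].
  rewrite shuffle_nilr inE; case: z => [x'|y'] /=; last by rewrite andbF.
  rewrite !eqseq_cons (inj_eq (@inl_inj _ _)) /= -andbA; congr andb.
  by rewrite -IH shuffle_nilr inE.
rewrite shuffle_cons mem_cat !mem_map_cons !IH.
case: z => [x'|y'] /=; rewrite ?(inj_eq (@inl_inj _ _)) ?(inj_eq (@inr_inj _ _)) eqseq_cons.
  by rewrite orbF andbA.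
by rewrite andbCA.
Qed.

Lemma uniq_shuffle s t : uniq (shuffle s t).
Proof.
elim: s t => [//|x s IHs]; elim=> [//|y t IHt].
rewrite shuffle_cons cat_uniq !map_inj_uniq ?IHs ?IHt /= ?andbT; try by move=> ? ? [].
by apply/hasPn => _ /mapP[w _ ->]; rewrite mem_map_cons.
Qed.

Lemma size_shuffle s t : size (shuffle s t) = 'C(size s + size t, size s).
Proof.
elim: s t => [|x s IHs]; first by move=> t; rewrite bin0.
elim=> [|y t IHt]; first by rewrite addn0 binn.
rewrite shuffle_cons size_cat !size_map IHs IHt /= [in RHS]addnS binS addnC.
by rewrite addSnnS.
Qed.

Lemma size_in_shuffle s t w :
  w \in shuffle s t -> size w = (size s + size t)%N.
Proof.
rewrite mem_shuffle => /andP[/eqP<- /eqP<-].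
by elim: w => //= -[x|y] w /= ->; rewrite ?addSn ?addnS.
Qed.

Lemma inl_part_rcons w z :
  inl_part (rcons w z) = if z is inl x then rcons (inl_part w) x else inl_part w.
Proof.
by rewrite -cats1 /inl_part pmap_cat; case: z => [x|y] /=; rewrite ?cats1 ?cats0.
Qed.

Lemma inr_part_rcons w z :
  inr_part (rcons w z) = if z is inr x then rcons (inr_part w) x else inr_part w.
Proof.
by rewrite -cats1 /inr_part pmap_cat; case: z => [x|y] /=; rewrite ?cats1 ?cats0.
Qed.

Lemma mem_map_rcons (z z' : P + Q) w (l : seq (seq (P + Q))) :
  (rcons w z' \in map (rcons^~ z) l) = (z' == z) && (w \in l).
Proof.
apply/mapP/andP => [[w' lw' /rcons_inj[-> ->]] // | [/eqP-> lw]].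
by exists w.
Qed.

(** [shuffle] splits on the first letter. Splitting on the last one suits [find], which is unchanged
    when a letter behind the first hit is removed. *)
Lemma shuffle_rcons s x t y :
  perm_eq (shuffle (rcons s x) (rcons t y))
    (map (rcons^~ (inl x)) (shuffle s (rcons t y))
      ++ map (rcons^~ (inr y)) (shuffle (rcons s x) t)).
Proof.
apply: uniq_perm; first exact: uniq_shuffle.
  rewrite cat_uniq !map_inj_uniq ?uniq_shuffle /= ?andbT; try exact: rcons_injl.
  by apply/hasPn => _ /mapP[w _ ->]; rewrite mem_map_rcons.
move=> w; case: (lastP w) => [|{}w z].
  rewrite mem_shuffle mem_cat (_ : (inl_part [::] == _) = false); last by case: (s).
  by symmetry; apply/negbTE/norP; split; apply/mapP => -[v _ /(congr1 size)]; rewrite size_rcons.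
rewrite mem_cat !mem_map_rcons !mem_shuffle inl_part_rcons inr_part_rcons.
case: z => [x'|y'] /=; rewrite ?(inj_eq (@inl_inj _ _)) ?(inj_eq (@inr_inj _ _)) eqseq_rcons.
  by rewrite orbF [in LHS](andbC (_ == s)) andbA.
by rewrite (andbC (_ == t)) andbCA.
Qed.

Lemma has_inl_part (a : pred (P + Q)) w :
  (forall y, a (inr y) = false) -> has a w = has (a \o inl) (inl_part w).
Proof. by move=> a0; elim: w => //= -[x|y] w /= ->; rewrite ?a0. Qed.

End Shuffle.

(** If only [z] satisfies [a], both sides are [size w], on the right as the value of [find] after a
    failed search. *)
Lemma find_rcons_has (T : Type) (a : pred T) (w : seq T) (z : T) :
  has a (rcons w z) -> find a (rcons w z) = find a w.
Proof.
rewrite has_rcons -cats1 find_cat.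
case: ifP => //= /negbT hasN; rewrite orbF => ->.
by rewrite addn0 hasNfind.
Qed.

Section ShuffleSums.
Context {R : realType}.

(* Averaged over the shuffles, a position measured among the letters of [s]
   gains exactly [harm (p + q) - harm p]. *)
Lemma sum_harm_find_shuffle (P Q : eqType) (a : pred (P + Q)) (s : seq P) (t : seq Q) :
  (forall y, a (inr y) = false) ->
  \sum_(w <- shuffle s t) harm (find a w)
    = 'C(size s + size t, size s)%:R
      * (harm (find (a \o inl) s) + harm (size s + size t) - harm (size s)) :> R.
Proof.
move=> a0; have [n] := ubnP (size s + size t).
elim: n s t => // n IH s t; rewrite ltnS => le_n.
(* Without a hit in [s], each shuffle gives the full length; otherwise the last letter can be
   removed from each shuffle. *)
have [has_s|hasN] := boolP (has (a \o inl) s); last first.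
  rewrite (hasNfind hasN) big_seq (eq_bigr (fun=> harm (size s + size t))).
    rewrite -big_seq big_const_seq iter_addr_0 count_predT size_shuffle.
    by rewrite -[LHS]mulr_natl [harm (size s) + _]addrC addrK.
  move=> w sh; rewrite hasNfind; first by rewrite (size_in_shuffle sh).
  rewrite has_inl_part //; move: sh; rewrite mem_shuffle => /andP[/eqP-> _].
  exact: hasN.
case: (lastP t) le_n => [|{}t y] le_n.
  by rewrite shuffle_nilr big_seq1 /= addn0 binn mul1r find_map addrK.
case: (lastP s) has_s le_n => [|{}s x] // has_s le_n.
have le1 : (size s + size (rcons t y) < n)%N by move: le_n; rewrite !size_rcons addSn.
have le2 : (size (rcons s x) + size t < n)%N.
  by move: le_n; rewrite !size_rcons addnS.
rewrite (perm_big _ (shuffle_rcons s x t y)) big_cat !big_map /=.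
under eq_big_seq => w sh.
  rewrite find_rcons_has; first over.
  rewrite has_inl_part // inl_part_rcons.
  by move: sh; rewrite mem_shuffle => /andP[/eqP-> _].
rewrite IH // addrC.
under eq_big_seq => w sh.
  rewrite find_rcons_has; first over.
  rewrite has_inl_part // inl_part_rcons.
  by move: sh; rewrite mem_shuffle => /andP[/eqP-> _].
rewrite {}IH // (find_rcons_has has_s) !size_rcons.
rewrite !addSn !addnS addrC; move: (find _ _) (size s) (size t) => k p q.
have := mul_bin_diag (p + q).+2 p.
move: (p + q)%N => n1 /(congr1 (fun k => k%:R : R)).
rewrite /= !natrM !(binS n1.+1) natrD (harmS n1.+1) (harmS p).

move: 'C(_, p)%:R 'C(_, p.+1)%:R (harm k) (harm n1.+1) (harm p) => A B u v w AB.
(* The absorption identity: it exchanges the increment [1 / (p + 1)], present in only one of the two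
   sums, for the increment [1 / (n1 + 2)] of the full length. *)
have {}AB : (B + A) / n1.+2%:R = A / p.+1%:R.
  by apply/eqP; rewrite eqr_div ?pnatr_eq0 // [A * _]mulrC AB mulrC.
transitivity ((B + A) * (u + v - w - p.+1%:R^-1) + A / p.+1%:R); first by ring.
by rewrite -AB; ring.
Qed.

End ShuffleSums.

Definition sum_swap {P Q : Type} (z : P + Q) : Q + P :=
  match z with inl x => inr x | inr y => inl y end.

Lemma sum_swapK P Q : cancel (@sum_swap P Q) sum_swap.
Proof. by case. Qed.

Lemma shuffleC (P Q : eqType) (s : seq P) (t : seq Q) :
  perm_eq (map (map sum_swap) (shuffle t s)) (shuffle s t).
Proof.
have inlE (w : seq (P + Q)) : inl_part (map sum_swap w) = inr_part w.
  by elim: w => //= -[y|x] w /= ->.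
have inrE (w : seq (P + Q)) : inr_part (map sum_swap w) = inl_part w.
  by elim: w => //= -[y|x] w /= ->.
apply: uniq_perm; rewrite ?uniq_shuffle //.
  by rewrite map_inj_uniq ?uniq_shuffle //; apply/inj_map/can_inj/sum_swapK.
move=> w; rewrite -[w in LHS](mapK (@sum_swapK _ _)) mem_map.
  by rewrite !mem_shuffle inlE inrE andbC.
exact/inj_map/can_inj/sum_swapK.
Qed.

Lemma shuffle_gainE (R : realType) p q :
  shuffle_gain p q = p%:R * (harm (p + q) - harm p)
                     + q%:R * (harm (p + q) - harm q) :> R.
Proof. by rewrite /shuffle_gain natrD; ring. Qed.

(** Letters of [t] never stop a letter of [s], so the contribution of a first letter from [s] is
    given by [sum_harm_find_shuffle]; a first letter from [t] is treated alike after the two sides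
    are exchanged by [shuffleC]. *)
Lemma sum_slack_shuffle (R : realType) (P Q : eqType) (lt : rel (P + Q))
    (ltP : rel P) (ltQ : rel Q) (s : seq P) (t : seq Q) :
  (forall x x', lt (inl x) (inl x') = ltP x x') ->
  (forall y y', lt (inr y) (inr y') = ltQ y y') ->
  (forall x y, lt (inl x) (inr y) = false) ->
  (forall x y, lt (inr y) (inl x) = false) ->
  \sum_(w <- shuffle s t) slack lt w
    = 'C(size s + size t, size s)%:R
      * (slack ltP s + slack ltQ t + shuffle_gain (size s) (size t)) :> R.
Proof.
move=> ltPE ltQE ltPQ ltQP.
elim: s t => [|x s IHs] t.
  rewrite big_seq1 bin0 mul1r add0r (slack_map _ _ ltQE) /shuffle_gain /=.
  by rewrite !add0n mul0r subr0 subrr addr0.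
elim: t => [|y t IHt].
  rewrite big_seq1 addn0 binn mul1r (slack_map _ _ ltPE).
  by rewrite /shuffle_gain /= addn0 mul0r !subr0 subrr !addr0.
rewrite shuffle_cons big_cat !big_map /= !big_split /= IHt IHs.
rewrite -[X in _ + (X + _) = _](perm_big _ (shuffleC (x :: s) t)) big_map.
under [X in _ + (X + _)]eq_bigr => w _ do rewrite find_map.
rewrite !sum_harm_find_shuffle //=.
rewrite (_ : find _ s = find (ltP x) s); last exact: (eq_find (ltPE x)).
rewrite (_ : find (preim _ _ \o _) t = find (ltQ y) t); last exact: (eq_find (ltQE y)).
rewrite (_ : 'C(size t + (size s).+1, size t)
              = 'C((size s + size t).+1, (size s).+1))%N; last first.
  by rewrite addnC -bin_sub ?leq_addl // addnK addSn.
rewrite (addnC (size t)) !shuffle_gainE !addSn !addnS (binS (size s + size t).+1) natrD.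
rewrite !harmS.
move: 'C(_, size s)%:R 'C(_, (size s).+1)%:R => A B.
move: (harm (find _ s)) (harm (find _ t)) (slack ltP s) (slack ltQ t) => h1 h2 u v.
move: (harm (size s)) (harm (size t)) (harm (_ + _)) => Hp Hq Hn.
move: (size s) (size t) => p q.
field.

by rewrite -!natrD !nat1r !pnatr_eq0.
Qed.

(** * Linear extensions as words *)

Section InlInrParts.
Context {P Q : eqType}.
Implicit Types (w : seq (P + Q)).

Lemma mem_inl_part w x : (x \in inl_part w) = (inl x \in w).
Proof.
elim: w => //= -[x'|y] w IH; rewrite !inE /= IH //.
Qed.

Lemma mem_inr_part w y : (y \in inr_part w) = (inr y \in w).
Proof.
elim: w => //= -[x|y'] w IH; rewrite !inE /= IH //.
Qed.

Lemma all_inl_inr (a : pred (P + Q)) w :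
  all a w = all (a \o inl) (inl_part w) && all (a \o inr) (inr_part w).
Proof.
elim: w => //= -[x|y] w -> /=; first by rewrite andbA.
by rewrite andbCA.
Qed.

Lemma pairwise_inl_inr (r : rel (P + Q)) (rP : rel P) (rQ : rel Q) w :
  (forall x x', r (inl x) (inl x') = rP x x') ->
  (forall y y', r (inr y) (inr y') = rQ y y') ->
  (forall x y, r (inl x) (inr y)) -> (forall x y, r (inr y) (inl x)) ->
  pairwise r w = pairwise rP (inl_part w) && pairwise rQ (inr_part w).
Proof.
move=> rPE rQE rPQ rQP; elim: w => //= -[x|y] w -> /=; rewrite all_inl_inr.
  have -> : all (r (inl x) \o inr) (inr_part w) by apply/allP => z _; apply: rPQ.
  by rewrite (eq_all (rPE x)) andbT andbA.
have -> : all (r (inr y) \o inl) (inl_part w) by apply/allP => z _; apply: rQP.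
by rewrite (eq_all (rQE y)) /= andbCA.
Qed.

End InlInrParts.

Lemma forall_mem_inl_inr (P Q : finType) (w : seq (P + Q)) :
  [forall x, x \in w]
    = [forall x, x \in inl_part w] && [forall y, y \in inr_part w].
Proof.
apply/forallP/andP => [wT|[/forallP wP /forallP wQ] [x|y]].
- by split; apply/forallP => z; rewrite ?mem_inl_part ?mem_inr_part; apply: wT.
- by rewrite -mem_inl_part.
- by rewrite -mem_inr_part.
Qed.

Section LinearWords.
Context {d : Order.disp_t}.

(** Linear extensions as words, lowest rank first. The test [~~ (y <= x)] also excludes repeated
    letters. *)
Definition linear_words (P : finPOrderType d) : seq (seq P) :=
  [seq w <- permutations (enum P) | pairwise (fun x y => ~~ (y <= x)%O) w].

Lemma uniq_linear_words P : uniq (linear_words P).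
Proof. by rewrite filter_uniq ?permutations_uniq. Qed.

Lemma mem_linear_words (P : finPOrderType d) (w : seq P) :
  (w \in linear_words P)
    = pairwise (fun x y => ~~ (y <= x)%O) w && [forall x, x \in w].
Proof.
rewrite mem_filter mem_permutations; case: (boolP (pairwise _ w)) => //= pw.
have uw : uniq w.
  by apply: pairwise_uniq pw => x; rewrite lexx.
apply/idP/forallP => [/perm_mem eqw x|wT]; first by rewrite eqw mem_enum.
by apply: uniq_perm; rewrite ?enum_uniq // => x; rewrite mem_enum wT.
Qed.

Lemma size_linear_word (P : finPOrderType d) (w : seq P) :
  w \in linear_words P -> size w = #|P|.
Proof.
by rewrite mem_filter mem_permutations cardE => /andP[_ /perm_size].
Qed.

Definition total_slack (R : realType) (P : finPOrderType d) : R :=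
  \sum_(w <- linear_words P) slack (fun x y => (x < y)%O) w.

Definition large_slack (R : realType) (P : finPOrderType d) : Prop :=
  (size (linear_words P))%:R * ln (size (linear_words P))%:R
    <= total_slack R P.

End LinearWords.

Lemma linear_words_iso (d1 d2 : Order.disp_t) (P : finPOrderType d1)
    (Q : finPOrderType d2) (f : P -> Q) :
  bijective f -> {mono f : x y / (x <= y)%O} ->
  perm_eq (map (map f) (linear_words P)) (linear_words Q).
Proof.
move=> fbij fmono; have finj := bij_inj fbij; have [g fK gK] := fbij.
apply: uniq_perm; rewrite ?uniq_linear_words //.
  by rewrite map_inj_uniq ?uniq_linear_words //; apply: inj_map.
move=> w; rewrite -[w](mapK gK) mem_map; last exact: inj_map.
rewrite !mem_linear_words [in RHS]pairwise_map; congr andb.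
  by apply: eq_in_pairwise (all_predT _) => x y _ _ /=; rewrite fmono.
apply/forallP/forallP => wT x; last by rewrite -(mem_map finj).
by rewrite -[x]gK mem_map.
Qed.

Lemma large_slack_iso (R : realType) (d1 d2 : Order.disp_t)
    (P : finPOrderType d1) (Q : finPOrderType d2) :
  isomorphic_posets P Q -> large_slack R P -> large_slack R Q.
Proof.
case=> f fbij fmono; have permPQ := linear_words_iso fbij fmono.
rewrite /large_slack /total_slack -(perm_size permPQ) -(perm_big _ permPQ) /=.
rewrite size_map big_map; under [X in _ -> _ <= X]eq_bigr => w _ do
  rewrite (slack_map R w (leW_mono fmono)).
by [].
Qed.

Lemma linear_words_series (d1 d2 : Order.disp_t) (P : finPOrderType d1)
    (Q : finPOrderType d2) :
  perm_eq (linear_words (series_comp P Q))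
    [seq map inl s ++ map inr t | s <- linear_words P, t <- linear_words Q].
Proof.
have inlE (s : seq P) (t : seq Q) : inl_part (map inl s ++ map inr t) = s.
  by elim: s => [|x s /= ->] //; elim: t.
have inrE (s : seq P) (t : seq Q) : inr_part (map inl s ++ map inr t) = t.
  by elim: s => [|x s /= ->] //; elim: t => //= y t ->.
apply: uniq_perm; rewrite ?uniq_linear_words //.
  apply: allpairs_uniq; rewrite ?uniq_linear_words //.
  move=> [s t] [s' t'] _ _ /= E.
  by rewrite -(inlE s t) E inlE -(inrE s t) E inrE.
move=> w; rewrite mem_linear_words.
have TE := forall_mem_inl_inr w.
have pwE s t : pairwise (fun x y : series_comp P Q => ~~ (y <= x)%O) (map inl s ++ map inr t)
   = pairwise (fun x y => ~~ (y <= x)%O) s && pairwise (fun x y => ~~ (y <= x)%O) t.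
  rewrite pairwise_cat !pairwise_map.
  rewrite (_ : allrel _ _ _ = true) //.
  by apply/allrelP => _ _ /mapP[x _ ->] /mapP[y _ ->].
apply/andP/allpairsP => [[pw]|[[s t] /= [sP tQ ->]]]; last first.
  split.
    rewrite pwE; move: sP tQ; rewrite !mem_linear_words.
    by move=> /andP[-> _] /andP[-> _].
  apply/forallP => -[x|y]; rewrite mem_cat.
    rewrite mem_map; last exact: inl_inj.
    by move: sP; rewrite mem_linear_words => /andP[_ /forallP->].
  rewrite orbC mem_map; last exact: inr_inj.
  by move: tQ; rewrite mem_linear_words => /andP[_ /forallP->].
(* No letter of [P] can follow a letter of [Q]. *)
have wE : w = map inl (inl_part w) ++ map inr (inr_part w).
  elim: w pw {TE} => //= -[x|y] w IH /andP[wx /IH {}IH] /=; first by rewrite -IH.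
  suff E : inl_part w = [::] by rewrite E /= {1}IH E.
  move: wx; rewrite all_inl_inr => /andP[].
  by case: (inl_part w).
rewrite TE => /andP[wP wQ]; exists (inl_part w, inr_part w); split => //=.
all: rewrite mem_linear_words ?wP ?wQ andbT.
all: by move: pw; rewrite {1}wE pwE => /andP[].
Qed.

(** No relation links the two parts, so a word is linear exactly when both of its parts are. *)
Lemma linear_words_parallel (d1 d2 : Order.disp_t) (P : finPOrderType d1)
    (Q : finPOrderType d2) :
  perm_eq (linear_words (parallel_comp P Q))
    [seq w | st <- [seq (s, t) | s <- linear_words P, t <- linear_words Q],
             w <- shuffle st.1 st.2].
Proof.
apply: uniq_perm; rewrite ?uniq_linear_words //.
  apply: allpairs_uniq_dep => [|st _|[st w] [st' w'] /=].
  - apply: allpairs_uniq; rewrite ?uniq_linear_words //.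
    by move=> [? ?] [? ?] _ _.
  - exact: uniq_shuffle.
  (* A word determines its two parts, so different pairs have no common shuffle. *)
  move=> /allpairsPdep[st1 [w1 [_ + [? ?]]]]; subst st1 w1.
  rewrite mem_shuffle => /andP[/eqP w1 /eqP w2].
  move=> /allpairsPdep[st1 [w1' [_ + [? ?]]]]; subst st1 w1'.
  rewrite mem_shuffle => /andP[/eqP w1' /eqP w2'] ww; subst w'.
  by case: st st' w1 w2 w1' w2' => ? ? [? ?] /= <- <- <- <-.
move=> w; rewrite mem_linear_words.
have TE := forall_mem_inl_inr w.
have pwE : pairwise (fun x y : parallel_comp P Q => ~~ (y <= x)%O) w
   = pairwise (fun x y => ~~ (y <= x)%O) (inl_part w)
     && pairwise (fun x y => ~~ (y <= x)%O) (inr_part w).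
  exact: pairwise_inl_inr.
rewrite TE pwE andbACA.
rewrite -(mem_linear_words (inl_part w)) -(mem_linear_words (inr_part w)).
apply/andP/allpairsPdep => [[wP wQ]|[st [w' [/allpairsP[[s t] /= [sP tQ ->]]]]]].
  exists (inl_part w, inr_part w), w; split=> //; last by rewrite mem_shuffle !eqxx.
  by apply/allpairsP; exists (inl_part w, inr_part w).
by rewrite mem_shuffle /= => /andP[/eqP sE /eqP tE] ->; rewrite sE tE.
Qed.

(** A letter of [s] that meets nothing larger in [s] is stopped by the first letter of [t], so it
    gains no room. *)
Lemma slack_series (R : realType) (P Q : Type) (lt : rel (P + Q))
    (ltP : rel P) (ltQ : rel Q) (s : seq P) (t : seq Q) :
  (forall x x', lt (inl x) (inl x') = ltP x x') ->
  (forall y y', lt (inr y) (inr y') = ltQ y y') ->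
  (forall x y, lt (inl x) (inr y)) ->
  slack lt (map inl s ++ map inr t) = slack ltP s + slack ltQ t :> R.
Proof.
move=> ltPE ltQE ltPQ; elim: s => [|x s IH] /=.
  by rewrite add0r (slack_map _ _ ltQE).
rewrite IH addrA find_cat has_map find_map size_map.
rewrite (eq_has (ltPE x)) (eq_find (ltPE x)); case: ifP => // /negbT /hasNfind ->.
by case: t {IH} => [|y t] /=; rewrite ?ltPQ addn0.
Qed.

Lemma mulr_lnM (R : realType) (m n : nat) :
  (m * n)%:R * ln (m * n)%:R
    = n%:R * (m%:R * ln m%:R) + m%:R * (n%:R * ln n%:R) :> R.
Proof.
case: m n => [|m] [|n]; rewrite ?muln0 ?mul0n ?mul0r ?mulr0 ?mul0r ?addr0 //.
by rewrite natrM lnM ?posrE ?ltr0n //; ring.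
Qed.

Lemma size_allpairs_shuffle (P Q : eqType) (l : seq (seq P * seq Q)) m n :
  (forall st, st \in l -> size st.1 = m /\ size st.2 = n) ->
  size [seq w | st <- l, w <- shuffle st.1 st.2] = (size l * 'C(m + n, m))%N.
Proof.
elim: l => //= st l IH H; rewrite size_cat size_map IH; last first.
  by move=> u ul; apply: H; rewrite inE ul orbT.
by rewrite size_shuffle; have [-> ->] := H st (mem_head _ _).
Qed.

(** * Total slack under series and parallel composition *)

Section SlackComposition.
Context (R : realType) (d1 d2 : Order.disp_t).
Context (P : finPOrderType d1) (Q : finPOrderType d2).

Local Notation NP := (size (linear_words P)).
Local Notation NQ := (size (linear_words Q)).

(** [c] is zero for a series composition and the shuffle gain for a parallel one. *)
Lemma sum_allpairs_additive (c : R) :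
  \sum_(st <- [seq (s, t) | s <- linear_words P, t <- linear_words Q])
    (slack (fun x y => (x < y)%O) st.1 + slack (fun x y => (x < y)%O) st.2 + c)
  = NQ%:R * total_slack R P + NP%:R * total_slack R Q + (NP * NQ)%:R * c.
Proof.
rewrite big_allpairs_dep /=.
under eq_bigr => s _ do
  rewrite big_split big_split /= !big_const_seq !count_predT !iter_addr_0.
rewrite !big_split /= !big_const_seq !count_predT !iter_addr_0.
rewrite sumrMnl -/(total_slack R P) -/(total_slack R Q).
move: (total_slack R P) (total_slack R Q) => a b.
move: NP NQ => m n.
by rewrite -[a *+ n]mulr_natl -[b *+ m]mulr_natl -mulrnA -[c *+ _]mulr_natl mulnC.
Qed.

Lemma large_slack_series :
  large_slack R P -> large_slack R Q -> large_slack R (series_comp P Q).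
Proof.
have ltP (x x' : P) : ((inl x : series_comp P Q) < inl x')%O = (x < x')%O.
  by rewrite !lt_neqAle (inj_eq (@inl_inj _ _)).
have ltQ (y y' : Q) : ((inr y : series_comp P Q) < inr y')%O = (y < y')%O.
  by rewrite !lt_neqAle (inj_eq (@inr_inj _ _)).
have ltPQ (x : P) (y : Q) : ((inl x : series_comp P Q) < inr y)%O.
  by rewrite lt_neqAle.
rewrite /large_slack {3}/total_slack.
rewrite (perm_size (linear_words_series P Q)) (perm_big _ (linear_words_series P Q)).
rewrite size_allpairs /= mulr_lnM big_allpairs_dep /= => lP lQ.
under eq_bigr => s _ do under eq_bigr => t _ do
  rewrite (slack_series R s t ltP ltQ ltPQ).
have := sum_allpairs_additive 0; rewrite mulr0 addr0 big_allpairs_dep /=.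
under eq_bigr => s _ do under eq_bigr => t _ do rewrite addr0.
by move=> ->; rewrite lerD // ler_wpM2l.
Qed.

(** The number of linear extensions acquires a binomial factor, and the logarithm of this factor is
    paid for by the shuffle gain. *)
Lemma large_slack_parallel :
  large_slack R P -> large_slack R Q -> large_slack R (parallel_comp P Q).
Proof.
have ltP (x x' : P) : ((inl x : parallel_comp P Q) < inl x')%O = (x < x')%O.
  by rewrite !lt_neqAle (inj_eq (@inl_inj _ _)).
have ltQ (y y' : Q) : ((inr y : parallel_comp P Q) < inr y')%O = (y < y')%O.
  by rewrite !lt_neqAle (inj_eq (@inr_inj _ _)).
have ltPQ (x : P) (y : Q) : ((inl x : parallel_comp P Q) < inr y)%O = false.
  by rewrite lt_neqAle.
have ltQP (x : P) (y : Q) : ((inr y : parallel_comp P Q) < inl x)%O = false.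
  by rewrite lt_neqAle.
rewrite /large_slack {3}/total_slack => lP lQ.
rewrite (perm_size (linear_words_parallel P Q)) (perm_big _ (linear_words_parallel P Q)).
have sizeE st : st \in [seq (s, t) | s <- linear_words P, t <- linear_words Q] ->
    size st.1 = #|P| /\ size st.2 = #|Q|.
  by case/allpairsP => -[s t] /= [/size_linear_word sP /size_linear_word tQ ->].
rewrite (size_allpairs_shuffle sizeE) size_allpairs /= big_allpairs_dep /=.
under eq_big_seq => st /sizeE[s1 s2].
  rewrite (sum_slack_shuffle R st.1 st.2 ltP ltQ ltPQ ltQP) s1 s2; over.
rewrite -big_distrr /= sum_allpairs_additive mulr_lnM addrC.
have := @ln_bin_le_shuffle_gain R #|P| #|Q|.
rewrite mulr_lnM mulrCA -mulrDr => le_gain; rewrite ler_wpM2l // addrC.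
by rewrite !lerD // ler_wpM2l.
Qed.

End SlackComposition.

Lemma large_slack_series_parallel (R : realType) (d : Order.disp_t)
    (P : finPOrderType d) : series_parallel P -> large_slack R P.
Proof.
elim=> {d P} [d P P1|d d1 d2 P P1 P2 _ l1 _ l2 iso|d d1 d2 P P1 P2 _ l1 _ l2 iso].
- rewrite /large_slack; apply: le_trans (sumr_ge0 _ _); last first.
    by move=> w _; apply: slack_ge0.
  have : (size (linear_words P) <= 1)%N.
    rewrite size_filter (leq_trans (count_size _ _)) //.
    by rewrite size_permutations ?enum_uniq // -cardE P1.
  by case: size => [|[|]] //; rewrite ?mul0r ?ln1 ?mulr0.
- exact: large_slack_iso iso (large_slack_series l1 l2).
- exact: large_slack_iso iso (large_slack_parallel l1 l2).
Qed.

(** * The adversary bound *)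

Section Amplitudes.
Context {R : realType}.

(** The norm on [R[i]] has its values in [R[i]], with imaginary part zero; this is the same number
    in the ordered field [R]. *)
Definition cabs (z : R[i]) : R := complex.Re `|z|.

Lemma cabsE z : `|z| = (cabs z)%:C%C.
Proof. by []. Qed.

Lemma cabs_ge0 z : 0 <= cabs z.
Proof. by rewrite -lecR -cabsE normr_ge0. Qed.

Lemma cabs_sub_le y z : cabs (y - z) <= cabs y + cabs z.
Proof. by rewrite -lecR rmorphD /= -!cabsE ler_normB. Qed.

Lemma cabs_sub_ge y z : `|cabs y - cabs z| <= cabs (y - z).
Proof.
have dist_le (y' z' : R[i]) : cabs y' - cabs z' <= cabs (y' - z').
  by rewrite -lecR rmorphB /= -!cabsE lerB_dist.
have := dist_le y z; have := dist_le z y.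
rewrite (_ : cabs (z - y) = cabs (y - z)); last by rewrite /cabs distrC.
rewrite ler_norml.
move: (cabs y) (cabs z) (cabs (y - z)) => a b c; lra.
Qed.

Context {m : nat}.
Implicit Types (u v : 'cV[R[i]]_m).

Definition sqnorm v : R := \sum_k cabs (v k 0) ^+ 2.

Lemma sqnormE v : (sqnorm v)%:C%C = (map_mx Num.conj v^T *m v) 0 0.
Proof.
rewrite mxE rmorph_sum; apply: eq_bigr => k _.
by rewrite rmorphXn /= -cabsE !mxE normCKC.
Qed.

Lemma sqnorm_unitary (U : 'M[R[i]]_m) v :
  U \is unitarymx -> sqnorm (U *m v) = sqnorm v.
Proof.
move=> /unitarymxP UU; apply: (@complexI R); rewrite !sqnormE.
by rewrite trmx_mul map_mxM -mulmxA (mulmxA _ U) (mulmx1C UU) mul1mx.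
Qed.

End Amplitudes.

(** * The effect of one oracle call on a distance *)

Section Oracle.
Context {R : realType} {A W : finType} {n : nat}.
Implicit Types (s t : A -> 'I_n) (k : 'I_#|qbasis A W|).

Definition query_index s k := enum_rank (query_map s (enum_val k)).

Lemma query_mapK s : involutive (@query_map A W n s).
Proof. by case=> [[[i j] b] w] /=; rewrite -addbA addbb addbF. Qed.

Lemma query_indexK s : involutive (query_index s).
Proof. by move=> k; rewrite /query_index enum_rankK query_mapK enum_valK. Qed.

Lemma oracleE s (v : qstate R (qbasis A W)) k :
  (comparison_oracle R W s *m v) k 0 = v (query_index s k) 0.
Proof.
rewrite mxE (bigD1 (query_index s k)) //= big1 ?addr0 => [|l neq].
  by rewrite mxE /query_index enum_rankK query_mapK eqxx mul1r.
rewrite mxE (negbTE (_ : enum_val k != query_map s (enum_val l))) ?mul0r //.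
by apply: contra neq => /eqP E; rewrite /query_index E query_mapK enum_valK.
Qed.

Lemma sqnorm_oracle s (v : qstate R (qbasis A W)) :
  sqnorm (comparison_oracle R W s *m v) = sqnorm v.
Proof.
rewrite /sqnorm [RHS](reindex_inj (inv_inj (query_indexK s))).
by apply: eq_bigr => k _; rewrite oracleE.
Qed.

Definition queried k : A * A := (enum_val k).1.1.

Definition flip_answer k : 'I_#|qbasis A W| :=
  let: (i, j, b, w) := enum_val k in enum_rank (i, j, ~~ b, w).

Lemma flip_answerK : involutive flip_answer.
Proof.
move=> k; rewrite /flip_answer.
case E : (enum_val k) => [[[i j] b] w].
by rewrite enum_rankK /= negbK -E enum_valK.
Qed.

Lemma queried_flip k : queried (flip_answer k) = queried k.
Proof.
rewrite /queried /flip_answer; case: (enum_val k) => [[[i j] b] w].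
by rewrite enum_rankK.
Qed.

Definition distinguishes s t (q : A * A) : bool :=
  (s q.1 <= s q.2)%N != (t q.1 <= t q.2)%N.

(** Both oracles permute the basis, and they disagree only on queries that separate [s] from [t], by
    a flip of the answer qubit. *)
Lemma query_index_diff s t k :
  query_index t (query_index s k)
    = if distinguishes s t (queried k) then flip_answer k else k.
Proof.
rewrite /query_index /queried /flip_answer enum_rankK /distinguishes.
rewrite -[k in RHS]enum_valK; case: (enum_val k) => [[[i j] b] w] /=.
rewrite enum_rankK /=.
by case: (s i <= s j)%N (t i <= t j)%N b => [] [] [].
Qed.

(** On a separated query the new term is at most [(|u| + |v'|)^2], with [v'] the flipped amplitude,
    while the old one was at least [(|u| - |v|)^2]. The difference of these bounds is the two cross
    terms plus [|v'|^2 - |v|^2]. *)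
Lemma sqnorm_oracle_diff s t (u v : qstate R (qbasis A W)) :
  sqnorm (comparison_oracle R W s *m u - comparison_oracle R W t *m v)
    <= sqnorm (u - v)
       + \sum_(k | distinguishes s t (queried k))
           (2 * cabs (u k 0) * cabs (v k 0)
            + 2 * cabs (u k 0) * cabs (v (flip_answer k) 0)).
Proof.
pose g k := query_index t (query_index s k).
have gE k : g k = if distinguishes s t (queried k) then flip_answer k else k.
  exact: query_index_diff.
have gK : involutive g.
  move=> k; rewrite !gE; case D: (distinguishes _ _ (queried k)).
    by rewrite queried_flip D flip_answerK.
  by rewrite D.
have -> : sqnorm (comparison_oracle R W s *m u - comparison_oracle R W t *m v)
    = \sum_k cabs (u k 0 - v (g k) 0) ^+ 2.
  rewrite [RHS](reindex_inj (inv_inj (query_indexK s))); apply: eq_bigr => k _.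
  by rewrite !mxE -/(_ *m _) /g query_indexK; congr (cabs (_ - _) ^+ 2); rewrite -oracleE mxE.
(* The squares [|v'|^2 - |v|^2] cancel only in the total, because [g] permutes the basis. *)
have norm_g : \sum_k (cabs (v (g k) 0) ^+ 2 - cabs (v k 0) ^+ 2) = 0.
  rewrite sumrB; apply/eqP; rewrite subr_eq0; apply/eqP.
  by rewrite [RHS](reindex_inj (inv_inj gK)).
rewrite -[leLHS]subr0 -[X in _ - X <= _]norm_g /sqnorm.
rewrite [X in _ <= _ + X]big_mkcond -big_split -sumrB /=.
apply: ler_sum => k _; rewrite !mxE.
rewrite gE; case: ifP => _; last by rewrite subrr subr0 addr0.
have := cabs_sub_ge (u k 0) (v k 0).
have := cabs_sub_le (u k 0) (v (flip_answer k) 0).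
have := cabs_ge0 (u k 0 - v (flip_answer k) 0).
have := cabs_ge0 (u k 0 - v k 0).
move: (cabs (_ - v k 0)) (cabs (_ - _)) => e c.
move: (cabs (u k 0)) (cabs (v k 0)) (cabs (v _ 0)) => a b b' e0 c0 c_le ab_le.
have c2 : c ^+ 2 <= (a + b') ^+ 2 by rewrite ler_sqr ?nnegrE // (le_trans c0).
have : (a - b) ^+ 2 <= e ^+ 2.
  by rewrite -[(a - b) ^+ 2]real_normK ?num_real // ler_sqr ?nnegrE.
by move: c2; rewrite !sqrrD sqrrN; lra.
Qed.

End Oracle.

(* AM-GM with weight 3/4: on the event, [2 |a| |b| <= 3/4 |a|^2 + 4/3 |b|^2],
   and the other way round off it. *)
Lemma sqnorm_diff_separated (R : realType) (m : nat) (p : pred 'I_m)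
    (u v : 'cV[R[i]]_m) :
  sqnorm u = 1 -> sqnorm v = 1 ->
  2%:R / 3%:R <= \sum_(k | p k) cabs (u k 0) ^+ 2 ->
  \sum_(k | p k) cabs (v k 0) ^+ 2 <= 1 / 3%:R ->
  1 / 9%:R <= sqnorm (u - v).
Proof.
rewrite /sqnorm => u1 v1 up vp.
have := u1; rewrite (bigID p) /= => uE.
have := v1; rewrite (bigID p) /= => vE.
pose lo (k : 'I_m) : R := if p k then 1 / 4%:R * cabs (u k 0) ^+ 2 - 1 / 3%:R * cabs (v k 0) ^+ 2
  else 1 / 4%:R * cabs (v k 0) ^+ 2 - 1 / 3%:R * cabs (u k 0) ^+ 2.
apply: (@le_trans _ _ (\sum_k lo k)).
  rewrite (bigID p) /=.
  rewrite (eq_bigr (fun k => 1 / 4%:R * cabs (u k 0) ^+ 2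
                             - 1 / 3%:R * cabs (v k 0) ^+ 2)); last first.
    by move=> k; rewrite /lo => ->.
  rewrite [X in _ + X](eq_bigr (fun k => 1 / 4%:R * cabs (v k 0) ^+ 2
                                         - 1 / 3%:R * cabs (u k 0) ^+ 2)); last first.
    by move=> k; rewrite /lo => /negbTE->.
  rewrite !sumrB -!mulr_sumr.
  move: uE vE up vp.
  move: (\sum_(k | p k) _ ^+ 2) (\sum_(k | p k) _ ^+ 2) => a b.
  move: (\sum_(k | _) _ ^+ 2) (\sum_(k | _) _ ^+ 2) => c d; lra.
apply: ler_sum => k _; rewrite !mxE.
have : (cabs (u k 0) - cabs (v k 0)) ^+ 2 <= cabs (u k 0 - v k 0) ^+ 2.
  by rewrite -[leLHS]real_normK ?num_real // ler_sqr ?nnegrE ?cabs_ge0 // cabs_sub_ge.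
apply: le_trans; rewrite /lo.
move: (cabs (u k 0)) (cabs (v k 0)) => a b.
case: ifP => _.
  have := sqr_ge0 (3%:R * a - 4%:R * b); rewrite !sqrrB; lra.
have := sqr_ge0 (3%:R * b - 4%:R * a); rewrite !sqrrB; lra.
Qed.

(** * The weighted adversary argument for an arbitrary family of edges *)

Section Adversary.
Context {R : realType} {A : finType} {n : nat}.

Local Notation input := {ffun A -> 'I_n}.

Context (S : {set input}) (E : finType) (edge : pred E) (src tgt : E -> input).
Context (weight : E -> R) (ratio : E -> A * A -> R) (K : R).

Hypothesis edge_src : forall e, edge e -> src e \in S.
Hypothesis edge_tgt : forall e, edge e -> tgt e \in S.
Hypothesis edge_neq : forall e, edge e -> src e != tgt e.
Hypothesis weight_ge0 : forall e, edge e -> 0 <= weight e.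
Hypothesis ratio_gt0 : forall e q, 0 < ratio e q.

Let cut e q := edge e && distinguishes (src e) (tgt e) q.

Hypothesis src_load : forall s q, s \in S ->
  \sum_(e | cut e q && (src e == s)) weight e * ratio e q <= K.
Hypothesis tgt_load : forall s q, s \in S ->
  \sum_(e | cut e q && (tgt e == s)) weight e / ratio e q <= K.

Section Progress.
Context {W : finType}.
Local Notation state := (qstate R (qbasis A W)).
Implicit Types (psi : input -> state) (k l : 'I_#|qbasis A W|).

Definition spread psi : R :=
  \sum_(e | edge e) weight e * sqnorm (psi (src e) - psi (tgt e)).

Lemma load_src_le psi k :
  \sum_(e | cut e (queried k)) weight e * ratio e (queried k) * cabs (psi (src e) k 0) ^+ 2
    <= \sum_(s in S) K * cabs (psi s k 0) ^+ 2.
Proof.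
rewrite (partition_big src (mem S)); last first.
  by move=> e /andP[/edge_src].
apply: ler_sum => s sS.
rewrite (eq_bigr (fun e => weight e * ratio e (queried k) * cabs (psi s k 0) ^+ 2)).
  by rewrite -mulr_suml ler_wpM2r ?sqr_ge0 // src_load.
by move=> e /andP[_ /eqP->].
Qed.

Lemma load_tgt_le psi k l :
  \sum_(e | cut e (queried k)) weight e / ratio e (queried k) * cabs (psi (tgt e) l 0) ^+ 2
    <= \sum_(s in S) K * cabs (psi s l 0) ^+ 2.
Proof.
rewrite (partition_big tgt (mem S)); last first.
  by move=> e /andP[/edge_tgt].
apply: ler_sum => s sS.
rewrite (eq_bigr (fun e => weight e / ratio e (queried k) * cabs (psi s l 0) ^+ 2)).
  by rewrite -mulr_suml ler_wpM2r ?sqr_ge0 // tgt_load.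
by move=> e /andP[_ /eqP->].
Qed.

(** Schur's test: [2ab <= r a^2 + b^2 / r] with [r = ratio e q] splits each product into a source
    part and a target part, which the two load hypotheses bound. The map [phi] is the identity or
    [flip_answer], for the two kinds of cross terms. *)
Lemma cross_terms_le psi (phi : 'I_#|qbasis A W| -> 'I_#|qbasis A W|) :
  injective phi -> (forall s, s \in S -> sqnorm (psi s) = 1) ->
  \sum_(e | edge e) weight e *
      \sum_(k : 'I_#|qbasis A W| | distinguishes (src e) (tgt e) (queried k))
        2 * cabs (psi (src e) k 0) * cabs (psi (tgt e) (phi k) 0)
    <= 2 * K * #|S|%:R.
Proof.
move=> phi_inj norm1.
under eq_bigr => e _ do rewrite mulr_sumr big_mkcond.
rewrite exchange_big /=.
have KN : \sum_(k < #|qbasis A W|) \sum_(s in S) K * cabs (psi s k 0) ^+ 2 = K * #|S|%:R.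
  rewrite exchange_big /= -[in RHS]sum1_card natr_sum mulr_sumr; apply: eq_bigr => s sS.
  by rewrite -mulr_sumr -/(sqnorm _) norm1 // mulr1.
(* One copy of [K * #|S|] pays for the sources; the other, reindexed by [phi], pays for the
   targets. *)
rewrite -mulrA mulr2n mulrDl mul1r -{2}KN -KN [X in _ <= _ + X](reindex_inj phi_inj) -big_split /=.
apply: ler_sum => k _; rewrite -big_mkcondr /=.
apply: le_trans (lerD (load_src_le psi k) (load_tgt_le psi k (phi k))).
rewrite -big_split /=; apply: ler_sum => e /andP[/weight_ge0 w0 _].
move: (ratio_gt0 e (queried k)); move: (ratio _ _) => r r0.
rewrite -!(mulrA (weight e)) -mulrDr ler_wpM2l //.
move: (cabs (psi (src e) k 0)) (cabs (psi (tgt e) (phi k) 0)) => a b.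
have -> : r * a ^+ 2 + r^-1 * b ^+ 2 = r^-1 * (r * a - b) ^+ 2 + 2 * a * b.
  by field; rewrite gt_eqF.
by rewrite lerDr mulr_ge0 ?sqr_ge0 // invr_ge0 ltW.
Qed.

(** The unitary preserves every distance and the oracle adds two families of cross terms, each at
    most [2 * K * #|S|]. *)
Lemma spread_step psi (U : qop R (qbasis A W)) :
  U \is unitarymx -> (forall s, s \in S -> sqnorm (psi s) = 1) ->
  spread (fun s => U *m (comparison_oracle R W s *m psi s))
    <= spread psi + 4 * K * #|S|%:R.
Proof.
move=> unitU norm1.
have cross1 := cross_terms_le (@inj_id _) norm1.
have cross2 := cross_terms_le (inv_inj flip_answerK) norm1.
apply: (@le_trans _ _ (spread psi + (2 * K * #|S|%:R + 2 * K * #|S|%:R))); last by lra.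
apply: le_trans (lerD (lexx _) (lerD cross1 cross2)).
rewrite -!big_split; apply: ler_sum => e ee /=.
rewrite -!mulrDr ler_wpM2l ?weight_ge0 // -mulmxBr sqnorm_unitary // -big_split.
exact: sqnorm_oracle_diff.
Qed.

Lemma spread_run psi (steps : seq (qop R (qbasis A W))) :
  {in steps, forall U, U \is unitarymx} ->
  (forall s, s \in S -> sqnorm (psi s) = 1) ->
  let run (s : input) := foldl (fun v U => U *m (comparison_oracle R W s *m v)) (psi s) steps in
  (forall s, s \in S -> sqnorm (run s) = 1)
  /\ spread run <= spread psi + 4 * K * #|S|%:R * (size steps)%:R.
Proof.
elim: steps psi => [|U steps IH] psi unit_steps norm1 /=; first by rewrite mulr0 addr0.
have unitU : U \is unitarymx by apply: unit_steps; rewrite mem_head.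
have [|s sS|norm_run le_run] := IH (fun s => U *m (comparison_oracle R W s *m psi s)).
- by move=> V Vs; apply: unit_steps; rewrite inE Vs orbT.
- by rewrite sqnorm_unitary // sqnorm_oracle norm1.
split=> //; apply: (le_trans le_run).
have := spread_step unitU norm1.
rewrite -[(size steps).+1%:R]natr1 mulrDr mulr1; lra.
Qed.

End Progress.

(** The common start state has spread 0, a query adds at most [4 * K * #|S|], and at the end each
    edge contributes at least a ninth of its weight; hence [36 = 9 * 4]. *)
Lemma adversary_bound (a : quantum_algorithm R A input) :
  (forall s, s \in S -> 2%:R / 3%:R <= output_probability a s s) ->
  \sum_(e | edge e) weight e <= 36 * K * #|S|%:R * (num_queries a)%:R.
Proof.
move=> solves.
pose start_state (s : input) : qstate R (qbasis A (workspace a)) :=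
  prelude a *m basis_state R (start a).
have norm_start s : s \in S -> sqnorm (start_state s) = 1.
  move=> _; rewrite sqnorm_unitary ?prelude_unitary // /sqnorm.
  rewrite (bigD1 (enum_rank (start a))) //= big1 ?addr0 => [|k neq].
    by rewrite mxE !eqxx /cabs normr1 expr1n.
  by rewrite mxE (negbTE neq) /cabs normr0 expr0n.
have spread0 : spread start_state = 0.
  rewrite /spread big1 // => e _; rewrite subrr /sqnorm big1 ?mulr0 // => k _.
  by rewrite mxE /cabs normr0 expr0n.
have [] := spread_run (@steps_unitary _ _ _ a) norm_start.
rewrite -/(final_state a) => norm_final; rewrite spread0 add0r => le_final.
suff : \sum_(e | edge e) weight e * (1 / 9) <= spread (fun s => final_state a s).
  move=> /le_trans/(_ le_final); rewrite -mulr_suml /num_queries.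
  move: (\sum_(e | _) _) => x; lra.
have success s : s \in S ->
    2%:R / 3%:R <= \sum_(k | output (enum_val k) == s) cabs (final_state a s k 0) ^+ 2.
  move=> /solves; rewrite /output_probability -lecR rmorphM fmorphV !rmorph_nat rmorph_sum /=.
  by under [X in _ -> _ <= X]eq_bigr => k _ do rewrite rmorphXn /= -cabsE.
apply: ler_sum => e ee; apply: ler_wpM2l; first exact: weight_ge0.
have sS := edge_src ee; have tS := edge_tgt ee.
apply: (@sqnorm_diff_separated _ _ (fun k => output (enum_val k) == src e)).
- exact: norm_final.
- exact: norm_final.
- exact: success.
have := norm_final _ tS; rewrite /sqnorm (bigID (fun k => output (enum_val k) == src e)) /=.
(* Outcomes that yield [tgt e] do not yield [src e], so the run on [tgt e] leaves at most 1/3 of its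
   mass on the event of answering [src e]. *)
have : \sum_(k | output (enum_val k) == tgt e) cabs (final_state a (tgt e) k 0) ^+ 2
    <= \sum_(k | output (enum_val k) != src e) cabs (final_state a (tgt e) k 0) ^+ 2.
  rewrite [leLHS]big_mkcond [leRHS]big_mkcond; apply: ler_sum => k _.
  case: eqP => [->|_]; last by case: ifP => _ //; apply: sqr_ge0.
  by rewrite eq_sym edge_neq.
have := success _ tS.
lra.
Qed.

End Adversary.

(** * Moves between linear extensions *)

Section HilbertSum.
Context {R : realType}.

Definition hilbert_term (a b : nat) : R :=
  (a + b).+1%:R^-1 * (Num.sqrt a.+1%:R / Num.sqrt b.+1%:R).

Lemma hilbert_term_ge0 a b : 0 <= hilbert_term a b.
Proof. by rewrite mulr_ge0 ?invr_ge0 ?divr_ge0 ?sqrtr_ge0. Qed.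

(** The row is split at [b = a + 1]; each half is compared with a telescoping sum of total at most
    2. *)
Lemma sum_hilbert_term_le4 a N : \sum_(0 <= b < N) hilbert_term a b <= 4.
Proof.
pose r (n : nat) : R := Num.sqrt n%:R.
have r_gt0 n : 0 < r n.+1 by rewrite sqrtr_gt0.
have r_sq n : r n ^+ 2 = n%:R by rewrite sqr_sqrtr.
have r_le n : r n <= r n.+1 by rewrite ler_sqrt // ler_nat.
have r_ge0 n : 0 <= r n := sqrtr_ge0 _.
have r2S n : r n.+1 ^+ 2 = r n ^+ 2 + 1 by rewrite !r_sq natr1.
have inv_le n : ((a + n).+1%:R^-1 : R) = (r a.+1 ^+ 2 + r n ^+ 2)^-1.
  by rewrite !r_sq -natrD addSn.
(* That is, [1 / sqrt (n + 1) <= 2 (sqrt (n + 1) - sqrt n)]. *)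
have gap n : 1 <= 2 * r n.+1 * (r n.+1 - r n).
  by have := r2S n; have := r_le n; have := r_ge0 n; have := r_gt0 n; nra.
(* Here [1 / (a + b + 1) <= 1 / (a + 1)], and [gap] telescopes. *)
have head n : (n <= a.+1)%N -> \sum_(0 <= b < n) hilbert_term a b <= 2 * r n / r a.+1.
  elim: n => [|n IH] le_n; first by rewrite big_geq // divr_ge0 ?mulr_ge0.
  rewrite big_nat_recr //=; apply: le_trans (lerD (IH (ltnW le_n)) (lexx _)) _.
  rewrite /hilbert_term inv_le -/(r _) -/(r _).
  have : (r a.+1 ^+ 2 + r n ^+ 2)^-1 * r a.+1 ^+ 2 <= 1.
    rewrite mulrC ler_pdivrMr ?mul1r ?lerDl ?sqr_ge0 //.
    by rewrite ltr_pwDl ?sqr_ge0 ?exprn_gt0.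
  move/le_trans/(_ (gap n)); move: (_ ^-1) (r_gt0 a) (r_gt0 n) => c.
  move: (r a.+1) (r n.+1) (r n) => x v u x0 v0 le_gap.
  rewrite -subr_ge0 (_ : _ - _ = (2 * v * (v - u) - c * x ^+ 2) / (x * v)).
    by rewrite divr_ge0 ?subr_ge0 // mulr_ge0 // ltW.
  by field; rewrite !gt_eqF.
(* Here the term at [b] is at most [2 sqrt (a + 1) (1 / sqrt b - 1 / sqrt (b + 1))]; with the
   constant 4 this bound agrees with [head] at [n = a + 1]. *)
have tail n : (a < n)%N -> \sum_(0 <= b < n) hilbert_term a b <= 4 - 2 * r a.+1 / r n.
  elim: n => // n IH; rewrite ltnS leq_eqVlt => /orP[/eqP<-|lt_n].
    apply: le_trans (head _ (leqnn _)) _.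
    by rewrite -!mulrA divff ?gt_eqF // !mulr1; lra.
  rewrite big_nat_recr //=; apply: le_trans (lerD (IH lt_n) (lexx _)) _.
  rewrite /hilbert_term inv_le -/(r _) -/(r _).
  have u0 : 0 < r n by rewrite -(prednK (leq_trans _ lt_n)).
  have le_c : (r a.+1 ^+ 2 + r n ^+ 2)^-1 * r n.+1 ^+ 2 <= 1.
    rewrite mulrC ler_pdivrMr; last by rewrite ltr_pwDl ?sqr_ge0 ?exprn_gt0.
    by rewrite mul1r r2S addrC lerD2r r_sq ler1n.
  have := gap n; have := r_le n; move: u0 le_c.
  move: (_ ^-1) (r_gt0 a) (r_gt0 n) => c.
  move: (r a.+1) (r n.+1) (r n) => x v u x0 v0 u0 le_c le_uv le_gap.
  rewrite -subr_ge0 (_ : _ - _ = x / (u * v ^+ 3) * (v * (2 * v * (v - u)) - u * (c * v ^+ 2))).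
    rewrite mulr_ge0 ?subr_ge0 //; last first.
      apply: (@le_trans _ _ u); first by rewrite ler_piMr // ltW.
      by apply: (le_trans le_uv); rewrite ler_peMr // ltW.
    by apply/ltW/divr_gt0 => //; apply/mulr_gt0/exprn_gt0.
  by field; rewrite !gt_eqF.
have [le_N|/tail/le_trans->//] := leqP N a.
  apply: le_trans (head _ (leqW le_N)) _; rewrite ler_pdivrMr //.
  have : r N <= r a.+1 by rewrite ler_sqrt // ler_nat leqW.
  have := r_gt0 a; lra.
by rewrite lerBlDr lerDl divr_ge0 ?mulr_ge0.
Qed.

Lemma sum_hilbert_term_inj_le4 (T : finType) (p : pred T) (h : T -> nat) (a : nat) :
  {in p &, injective h} -> \sum_(e | p e) hilbert_term a (h e) <= 4.
Proof.
move=> h_inj; pose N := \max_(e | p e) h e.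
have le_N e : p e -> (h e <= N)%N by move=> pe; apply: leq_bigmax_cond.
pose h' e : 'I_N.+1 := inord (h e).
have h'E e : p e -> h' e = h e :> nat by move=> pe; rewrite inordK // ltnS le_N.
have h'_inj : {in p &, injective h'}.
  by move=> e f pe pf /(congr1 val); rewrite /= !h'E //; apply: h_inj.
rewrite (eq_bigr (fun e => hilbert_term a (h' e))); last by move=> e pe; rewrite h'E.
apply: le_trans (sum_hilbert_term_le4 a N.+1).
have := big_imset (fun b : 'I_N.+1 => hilbert_term a b) h'_inj => /= <-.
rewrite big_mkord [leLHS]big_mkcond; apply: ler_sum => b _.
by case: ifP => // _; apply: hilbert_term_ge0.
Qed.

End HilbertSum.

(** * Moves and their loads *)

Section Moves.
Context {d : Order.disp_t} (P : finPOrderType d).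
Local Notation ranking := {ffun P -> 'I_#|P|}.
Implicit Types (s t : ranking) (x y z : P) (q : P * P).

(* The edge [(s, x, y)] moves [x] up to the rank of [y] in [s]; the last
   condition says that no element above [x] is passed. *)
Definition is_move (e : ranking * P * P) : bool :=
  let: (s, x, y) := e in
  [&& s \in linear_extensions P, (s x < s y)%N
    & [forall z, (x < z)%O ==> (s y < s z)%N]].

(** The passed elements go down by one rank. The default of [insubd] is never taken, since the
    predecessor of a rank is in range. *)
Definition moved (e : ranking * P * P) : ranking :=
  let: (s, x, y) := e in
  [ffun z => if z == x then s y
             else if (s x < s z <= s y)%N then insubd (s z) (s z).-1 else s z].

Lemma movedE s x y z :
  moved (s, x, y) z
    = (if z == x then s y : nat else if s x < s z <= s y then (s z).-1 else s z)%N :> nat.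
Proof.
rewrite ffunE; case: ifP => // _; case: ifP => // _.
by rewrite val_insubd (leq_ltn_trans (leq_pred _)).
Qed.

Lemma linear_extensionP s :
  reflect (injective s /\ forall x y, (x <= y)%O -> (s x <= s y)%N)
          (s \in linear_extensions P).
Proof.
rewrite inE; apply: (iffP andP) => [[/injectiveP sI /forallP sM]|[sI sM]].
  by split=> // x y; have /forallP/(_ y)/implyP := sM x.
split; first exact/injectiveP.
by apply/forallP => x; apply/forallP => y; apply/implyP/sM.
Qed.

Lemma moved_linear_extension s x y :
  is_move (s, x, y) -> moved (s, x, y) \in linear_extensions P.
Proof.
case/and3P => /linear_extensionP[sI sM] xy /forallP up.
have sne z z' : z != z' -> s z <> s z' :> nat.
  by move=> /eqP zz' /val_inj/sI.
apply/linear_extensionP; split=> [z z' /(congr1 val) /=|z z' zz'].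
  have [-> //|/sne nzz'] := eqVneq z z'; rewrite !movedE => E; exfalso.
  move: E nzz'; case: eqVneq => [->|/sne]; case: eqVneq => [->|/sne]; do ?[case: ifP]; lia.
rewrite !movedE; have := sM _ _ zz'.
have [-> //|zne] := eqVneq z z'.
have zz'lt : (z < z')%O by rewrite lt_neqAle zne.
have := sne _ _ zne.
case: (eqVneq z x) => [zx|/sne]; case: (eqVneq z' x) => [z'x|/sne]; do ?[case: ifP];
  try lia; try (rewrite z'x; lia).
(* In the remaining cases [z] is the moved element and [z'] lies above it, so [z'] is not passed. *)
all: by have := up z'; rewrite -zx zz'lt /=; lia.
Qed.

Lemma moved_neq s x y : is_move (s, x, y) -> s != moved (s, x, y).
Proof.
case/and3P => _ xy _; apply/eqP => /(congr1 (fun f : ranking => f x : nat)).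
by rewrite movedE eqxx; lia.
Qed.

Definition passed x q : P := if q.1 == x then q.2 else q.1.

(** Two elements other than [x] keep their relative order, and [x] changes its order only with the
    elements it passes. *)
Lemma distinguishes_move s x y q :
  is_move (s, x, y) -> distinguishes s (moved (s, x, y)) q ->
  (s x < s (passed x q) <= s y)%N /\ (q = (x, passed x q) \/ q = (passed x q, x)).
Proof.
case/and3P => /linear_extensionP[sI sM] xy _.
have sne z z' : z != z' -> s z <> s z' :> nat.
  by move=> /eqP zz' /val_inj/sI.
case: q => i j D; rewrite /passed /=.
have {D} : (s i <= s j)%N != (moved (s, x, y) i <= moved (s, x, y) j)%N := D.
rewrite !movedE.
case: (eqVneq i x) => [->|/sne six]; case: (eqVneq j x) => [->|/sne sjx].
- by rewrite !leqnn.
- by case: ifP => C D; split; [| left | exfalso | left] => //; lia.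
- by case: ifP => C D; split; [| right | exfalso | right] => //; lia.
- have [->|/sne sij] := eqVneq i j; first by rewrite !leqnn eqxx.
  by case: ifP => C; case: ifP => C' D; exfalso; lia.
Qed.

Lemma moved_passed s x y z :
  (s x < s z <= s y)%N ->
  moved (s, x, y) z = (s z).-1 :> nat /\ moved (s, x, y) x = s y :> nat.
Proof.
move=> xzy; rewrite !movedE eqxx xzy.
by case: eqVneq => // zx; subst z; lia.
Qed.

(** A move can be undone from its target, the moved element and the initial rank of that element:
    the final rank of [x] is that of [y], and the passed elements go back up by one. *)
Lemma moved_inj s s' x y y' :
  is_move (s, x, y) -> is_move (s', x, y') -> s x = s' x ->
  moved (s, x, y) = moved (s', x, y') -> (s, x, y) = (s', x, y').
Proof.
case/and3P => /linear_extensionP[sI _] xy _ /and3P[/linear_extensionP[sI' _] xy' _] sx E.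
have Ez z : moved (s, x, y) z = moved (s', x, y') z :> nat by rewrite E.
have sy : s y = s' y' :> nat by have := Ez x; rewrite !movedE eqxx.
have sE z : s z = s' z :> nat.
  have [-> //|zx] := eqVneq z x; first by rewrite sx.
  have sz : s z <> s x :> nat by move=> /val_inj/sI/eqP; rewrite (negbTE zx).
  have sz' : s' z <> s x :> nat by rewrite sx => /val_inj/sI'/eqP; rewrite (negbTE zx).
  have := Ez z; rewrite !movedE (negbTE zx) -sy -sx; do 2![case: ifP]; lia.
have ss' : s = s' by apply/ffunP => z; apply/val_inj/sE.
by subst s'; move/val_inj/sI: sy => ->.
Qed.

Context {R : realType}.

Definition move_weight (e : ranking * P * P) : R :=
  let: (s, x, y) := e in (s y - s x)%:R^-1.

(* The weights of Schur's test for Hilbert's matrix: [sqrt ((a+1) / (b+1))],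
   where [a] elements lie strictly between the moved element and the compared
   one, and the move goes [b] ranks beyond the latter. *)
Definition move_ratio (e : ranking * P * P) q : R :=
  let: (s, x, y) := e in
  Num.sqrt (s (passed x q) - s x).-1.+1%:R / Num.sqrt (s y - s (passed x q)).+1%:R.

Lemma move_weight_ge0 e : 0 <= move_weight e.
Proof. by case: e => [[s x] y]; rewrite invr_ge0. Qed.

Lemma move_ratio_gt0 e q : 0 < move_ratio e q.
Proof. by case: e => [[s x] y]; rewrite divr_gt0 ?sqrtr_gt0 ?ltr0n. Qed.

(** Before the move, the moved element [x0] is the lower one of the query. Only the number of ranks
    beyond [z0] remains free, and it determines the move, so the load is part of one row of
    Hilbert's matrix. *)
Lemma move_src_load s q :
  \sum_(e | is_move e && distinguishes e.1.1 (moved e) q && (e.1.1 == s))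
    move_weight e * move_ratio e q <= 4.
Proof.
case: q => i j.
pose x0 := if (s i < s j)%N then i else j.
pose z0 := if (s i < s j)%N then j else i.
have H e : is_move e && distinguishes e.1.1 (moved e) (i, j) && (e.1.1 == s) ->
    [/\ is_move e, e.1.1 = s, e.1.2 = x0, passed e.1.2 (i, j) = z0 & (s x0 < s z0 <= s e.2)%N].
  case: e => [[s' x] y] /= /andP[/andP[mv /(distinguishes_move mv)[]] + + /eqP E].
  subst s'; rewrite /x0 /z0; move: (passed x (i, j)) => z /andP[xz zy].
  by case=> -[-> ->]; rewrite ?xz ?(ltnNge (s z)) ?(ltnW xz) /= ?xz ?zy.
rewrite (eq_bigr (fun e : ranking * P * P =>
    hilbert_term (s z0 - s x0).-1 (s e.2 - s z0))); last first.
  move=> e /H; case: e => [[s' x] y] /= [_ -> -> -> lt_z].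
  rewrite /hilbert_term; congr (_%:R^-1 * _); lia.
apply: sum_hilbert_term_inj_le4 => e e' /H + /H.
case: e => [[s1 x1] y1]; case: e' => [[s2 x2] y2] /=.
move=> [mv s1E -> _ lt1] [_ s2E -> _ lt2] E; rewrite s1E in mv.
have /and3P[/linear_extensionP[sI _] _ _] := mv.
rewrite s1E s2E (_ : y1 = y2) //; apply/sI/val_inj => /=.
by move: lt1 lt2 E; lia.
Qed.

(** After the move, the moved element [x0] is the higher one. Its initial rank remains free and
    determines the move by [moved_inj]. The two indices of the Hilbert term exchange their roles, in
    accordance with the inverted ratio. *)
Lemma move_tgt_load t q :
  \sum_(e | is_move e && distinguishes e.1.1 (moved e) q && (moved e == t))
    move_weight e / move_ratio e q <= 4.
Proof.
case: q => i j.
pose x0 := if (t i < t j)%N then j else i.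
pose z0 := if (t i < t j)%N then i else j.
have H e : is_move e && distinguishes e.1.1 (moved e) (i, j) && (moved e == t) ->
    [/\ is_move e, moved e = t, e.1.2 = x0, passed e.1.2 (i, j) = z0 &
      [/\ (e.1.1 x0 < e.1.1 z0 <= e.1.1 e.2)%N, t z0 = (e.1.1 z0).-1 :> nat
        & t x0 = e.1.1 e.2 :> nat]].
  case: e => [[s x] y] /= /andP[/andP[mv /(distinguishes_move mv)[]] + + /eqP E].
  rewrite /x0 /z0; move: (passed x (i, j)) => z lt_z qE.
  have [] := moved_passed lt_z.
  have tE w : moved (s, x, y) w = t w :> nat by rewrite -E.
  rewrite !tE => tz tx.
  have lt_t : (t z < t x)%N by rewrite tz tx; lia.
  by case: qE => -[-> ->]; rewrite ?lt_t ?(ltnNge (t x)) ?(ltnW lt_t).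
rewrite (eq_bigr (fun e : ranking * P * P =>
    hilbert_term (t x0 - t z0).-1 (t z0 - e.1.1 x0))); last first.
  move=> e /H; case: e => [[s x] y] /= [mv _ -> -> [lt_z tz tx]]; rewrite /hilbert_term.
  rewrite invf_div; congr (_%:R^-1 * (Num.sqrt _%:R / Num.sqrt _%:R)); lia.
apply: sum_hilbert_term_inj_le4 => e e' /H + /H.
case: e => [[s1 x1] y1]; case: e' => [[s2 x2] y2] /=.
move=> [mv1 E1 x1E _ [lt1 tz1 tx1]] [mv2 E2 x2E _ [lt2 tz2 tx2]] E; subst x1 x2.
apply: (moved_inj mv1 mv2); last exact: etrans E1 (esym E2).
by apply: val_inj => /=; move: lt1 tz1 lt2 tz2 E; lia.
Qed.

End Moves.

(** * The slack of a word as a sum over moves *)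

Section SlackAsSum.
Context {R : realType} {T : eqType} (lt : rel T).
Implicit Types (w : seq T).

(** The two order conditions of [is_move], read on a word. *)
Definition can_follow w x y : bool :=
  (index x w < index y w)%N
  && all (fun z => lt x z ==> (index y w < index z w)%N) w.

Lemma sum_index_lt w (k : nat) (F : nat -> R) : uniq w -> (k <= size w)%N ->
  \sum_(y <- w | (index y w < k)%N) F (index y w) = \sum_(0 <= i < k) F i.
Proof.
case: w => [|x0 w] uw le_k.
  by rewrite big_nil big_geq //; case: k le_k.
rewrite (big_nth x0) (big_nat_widen _ _ _ _ _ le_k) [LHS]big_nat_cond [RHS]big_nat_cond.
apply: eq_big => [i|i /andP[lt_i _]]; last by rewrite index_uniq.
by case lt_i: (i < size (x0 :: w))%N => //; rewrite index_uniq.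
Qed.

Lemma all_index_lt_find w (a : pred T) y : uniq w -> y \in w ->
  all (fun z => a z ==> (index y w < index z w)%N) w = (index y w < find a w)%N.
Proof.
move=> uw yw; apply/allP/idP => [H|lt_y z zw]; last first.
  apply/implyP => az; apply: (leq_trans lt_y); rewrite leqNgt.
  by apply/negP => /(before_find z); rewrite nth_index ?az.
have [has_a|/hasNfind->] := boolP (has a w); last by rewrite index_mem.
have := H (nth y w (find a w)); rewrite mem_nth -?has_find // nth_find // => /(_ isT).
by rewrite index_uniq -?has_find.
Qed.

(** The harmonic number of the head is the sum of [1 / m] over the distances [m] it can move. For
    the later letters, the head shifts all indices by one and, not being above them, imposes no
    constraint. *)
Lemma slackE w : irreflexive lt -> uniq w -> pairwise (fun x y => ~~ lt y x) w ->
  slack lt w = \sum_(x <- w) \sum_(y <- w | can_follow w x y)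
                 (index y w - index x w)%:R^-1 :> R.
Proof.
move=> lt_irr; elim: w => [|x w IH]; first by rewrite big_nil.
move=> /andP[xw uw] /andP[/allP lt_x pw]; rewrite big_cons /= IH //.
have neq y : y \in w -> (x == y) = false.
  by move=> yw; apply: contraNF xw => /eqP->.
congr (_ + _).
  rewrite big_cons (_ : can_follow _ x x = false); last by rewrite /can_follow ltnn.
  rewrite /harm -(sum_index_lt _ uw (find_size (lt x) w)).
  rewrite [LHS]big_seq_cond [RHS]big_seq_cond.
  apply: eq_big => [y|y /andP[yw _]]; last by rewrite eqxx subn0 neq.
  case yw: (y \in w) => //=; rewrite /can_follow /= eqxx neq //= lt_irr /=.
  rewrite -all_index_lt_find //; apply: eq_in_all => z zw /=; rewrite neq //.
apply: eq_big_seq => z zw.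
rewrite big_cons (_ : can_follow _ z x = false); last first.
  by rewrite /can_follow /= eqxx ltn0.
rewrite [LHS]big_seq_cond [RHS]big_seq_cond.
apply: eq_big => [y|y /andP[yw _]]; last by rewrite /= (neq y) // (neq z) // subSS.
case yw: (y \in w) => //=; rewrite /can_follow /= (neq y) // (neq z) // ltnS.
rewrite (negbTE (lt_x _ zw)) eqxx /=.
congr andb; by apply: eq_in_all => u uw' /=; rewrite (neq u).
Qed.

End SlackAsSum.

(** * Correspondence between words and rankings *)

Section Ranks.
Context {d : Order.disp_t} {P : finPOrderType d}.
Local Notation ranking := {ffun P -> 'I_#|P|}.
Implicit Types (w : seq P) (s : ranking).

(** On a linear word every index is a rank, so the default [enum_rank x] is not reached there. *)
Definition ranks w : ranking := [ffun x => insubd (enum_rank x) (index x w)].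

Lemma mem_linear_word w x : w \in linear_words P -> x \in w.
Proof. by rewrite mem_linear_words => /andP[_ /forallP]. Qed.

Lemma ranksE w x : w \in linear_words P -> ranks w x = index x w :> nat.
Proof.
move=> lw; rewrite ffunE val_insubd.
have -> // : (index x w < #|P|)%N.
by rewrite -(size_linear_word lw) index_mem mem_linear_word.
Qed.

Lemma ranks_inj : {in linear_words P &, injective ranks}.
Proof.
move=> w w' lw lw' E.
have size_eq : size w = size w' by rewrite !size_linear_word.
case: w => [|x0 w] in lw E size_eq *; first by case: w' {lw' E} size_eq.
apply: (@eq_from_nth _ x0) => // k lt_k.
have uw : uniq (x0 :: w).
  move: lw; rewrite mem_linear_words => /andP[pw _].
  by apply: pairwise_uniq pw => x; rewrite lexx.
have := ranksE (nth x0 (x0 :: w) k) lw'.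
rewrite -E ranksE // index_uniq // => kE.
by rewrite [in RHS]kE nth_index // mem_linear_word.
Qed.

Lemma ranks_linear_extension w :
  w \in linear_words P -> ranks w \in linear_extensions P.
Proof.
move=> lw; apply/linear_extensionP; split=> [x y /(congr1 val) /=|x y xy].
  rewrite !ranksE // => E; rewrite -(nth_index x (mem_linear_word x lw)) E.
  by rewrite nth_index // mem_linear_word.
rewrite !ranksE // leqNgt; apply/negP => lt_yx.
have := lw; rewrite mem_linear_words => /andP[/(pairwiseP x)/(_ _ _ _ _ lt_yx)].
by rewrite !inE !index_mem !mem_linear_word // !nth_index ?mem_linear_word // xy => /(_ isT isT).
Qed.

Lemma linear_extension_ranks s :
  s \in linear_extensions P -> exists2 w, w \in linear_words P & s = ranks w.
Proof.
move=> /linear_extensionP[sI sM].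
(* The word lists the elements by rank, through the inverse [g] of [s]. *)
have [g gK Kg] : bijective s by apply: inj_card_bij; rewrite ?card_ord.
have lw : map g (enum 'I_#|P|) \in linear_words P.
  rewrite mem_linear_words; apply/andP; split; last first.
    by apply/forallP => x; rewrite -[x]gK map_f ?mem_enum.
  rewrite pairwise_map.
  have : pairwise ltn (map val (enum 'I_#|P|)).
    by rewrite val_enum_ord -sorted_pairwise ?iota_ltn_sorted //; apply: ltn_trans.
  rewrite pairwise_map; apply: sub_pairwise => k l /= kl.
  by apply: contraL kl => /sM; rewrite !Kg -leqNgt.
exists (map g (enum 'I_#|P|)) => //; apply/ffunP => x; apply: val_inj => /=.
rewrite ranksE // -[x in RHS]gK index_map; last exact: can_inj Kg.
by rewrite index_enum_ord.
Qed.

Lemma perm_ranks :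
  perm_eq (map ranks (linear_words P)) (enum (linear_extensions P)).
Proof.
apply: uniq_perm; rewrite ?enum_uniq ?map_inj_in_uniq ?uniq_linear_words //.
  exact: ranks_inj.
move=> s; rewrite mem_enum; apply/mapP/idP => [[w lw ->]|].
  exact: ranks_linear_extension.
by case/linear_extension_ranks => w lw ->; exists w.
Qed.

Lemma card_linear_extensions : #|linear_extensions P| = size (linear_words P).
Proof. by rewrite cardE -(perm_size perm_ranks) size_map. Qed.

(** This links the words, on which the slack is computed by induction over the poset, to the
    rankings, on which the adversary acts. *)
Lemma total_slack_moves (R : realType) :
  total_slack R P = \sum_(e | is_move e) @move_weight d P R e.
Proof.
transitivity (\sum_(s in linear_extensions P) \sum_x \sum_(y | is_move (s, x, y))
    @move_weight d P R (s, x, y)).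
  rewrite -big_enum -(perm_big _ perm_ranks) big_map /=.
  apply: eq_big_seq => w lw.
  have pw : perm_eq w (index_enum P).
    move: lw; rewrite mem_filter mem_permutations => /andP[_].
    by rewrite enumT.
  have uw : uniq w by rewrite (perm_uniq pw) index_enum_uniq.
  have rw : pairwise (fun x y => ~~ (y < x)%O) w.
    move: lw; rewrite mem_linear_words => /andP[+ _]; apply: sub_pairwise => x y.
    by apply: contra; apply: ltW.
  rewrite (slackE (@ltxx _ P) uw rw).
  rewrite (perm_big _ pw); apply: eq_bigr => x _.
  rewrite (perm_big _ pw); apply: eq_big => [y|y _].
    rewrite /= ranks_linear_extension //= !ranksE // /can_follow; congr andb.
    apply/allP/forallP => H z; last by move=> _; have := H z; rewrite ranksE.
    by rewrite ranksE // H // mem_linear_word.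
  by rewrite /= !ranksE.
rewrite pair_big /= pair_big_dep /=.
apply: eq_big => [[[s x] y]|[[s x] y] _ //] /=.
by rewrite andbA andbT andbb.
Qed.

End Ranks.

Theorem theorem2 (R : realType) :
  exists2 c : R, (0 < c)%R &
    forall (d : Order.disp_t) (P : finPOrderType d), series_parallel P ->
      ((c * ln (#|linear_extensions P|%:R))%:E
         <= sort_quantum_query_complexity R P)%E.
Proof.
(* [144 = 36 * 4]: the constant of [adversary_bound] times the bound 4 on the loads. *)
exists (1 / 144); first by rewrite divr_gt0.
move=> d P sp; apply/ereal_infP => _ [a solves <-]; rewrite lee_fin.
have : \sum_(e | is_move e) @move_weight d P R e
    <= 36 * 4 * #|linear_extensions P|%:R * (num_queries a)%:R :> R.
  refine (@adversary_bound R P _ (linear_extensions P) _ (@is_move d P)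
            (fun e => e.1.1) (@moved d P) (@move_weight d P R)
            (@move_ratio d P R) 4 _ _ _ _ _ _ _ a solves).
  - by move=> [[s x] y] /and3P[].
  - by move=> [[s x] y]; apply: moved_linear_extension.
  - by move=> [[s x] y]; apply: moved_neq.
  - by move=> e _; apply: move_weight_ge0.
  - by move=> e q; apply: move_ratio_gt0.
  - by move=> s q _; apply: move_src_load.
  - by move=> s q _; apply: move_tgt_load.
rewrite -total_slack_moves => /(le_trans (large_slack_series_parallel R sp)).
rewrite -card_linear_extensions; move: #|_| => N.
(* By convention [ln 0 = 0], which settles [N = 0]; otherwise the common factor [N] is cancelled. *)
case: N => [|N]; first by rewrite ln0 ?mulr0 ?ler0n.
rewrite -[36 * 4 * _ * _]mulrA mulrCA ler_pM2l ?ltr0n //; lra.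
Qed.
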